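(* Let $K,N,N_r,M,S$ be positive integers with $N_r\le N$, $M<N$, $N_r>N-M$, and $N-N_r+2\le S\le N$. Consider the $(K,N,N_r,M,S)$ secure gradient coding problem with uncoded groupwise keys. Then for every data assignment $\mathcal D_1,\dots,\mathcal D_K\subseteq[N]$ with $|\mathcal D_k|\ge M$ for all $k\in[K]$, the communication cost $$R=\frac{\binom{N}{S}-\binom{M}{S}}{\left(\binom{N}{S}-\binom{M}{S}\right)N_r-\binom{N}{S}(N-M)}$$ is achievable.
   Context: Notation: $[n]=\{1,\dots,n\}$; $\binom{\mathcal X}{y}$ is the collection of $y$-element subsets of a set $\mathcal X$; $\binom{x}{y}=0$ if $x<y$. $\mathbb F_q$ is a finite field and entropies $H$ and mutual informations $I$ are in base $q$. The $(K,N,N_r,M,S)$ secure gradient coding problem with uncoded groupwise keys: there are $K$ datasets, with gradients $g_1,\dots,g_K\in\mathbb F_q^{L}$ that are mutually independent, each consisting of $L$ i.i.d. uniform symbols on $\mathbb F_q$, and $N$ servers. Data assignment (fixed in advance, arbitrary): dataset $k$ is available exactly at the servers in $\mathcal D_k\subseteq[N]$, where $|\mathcal D_k|\ge M$; write $\mathcal Z_n=\{k\in[K]: n\in\mathcal D_k\}$ for the datasets held by server $n$. Keys: for each $\mathcal V\in\binom{[N]}{S}$ there is a random key $Q_{\mathcal V}$ (its distribution is chosen by the scheme) known exactly to the servers in $\mathcal V$. All keys and all gradients are mutually independent: $H\big((Q_{\mathcal V})_{\mathcal V\in\binom{[N]}{S}},(g_k)_{k\in[K]}\big)=\sum_{\mathcal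 V}H(Q_{\mathcal V})+\sum_{k}H(g_k)$. A secure gradient coding scheme with block length $L$ consists of a choice of keys and of messages $X_1,\dots,X_N$, where $X_n$ is a vector of $|X_n|$ symbols of $\mathbb F_q$ sent by server $n$ to the user, such that: (i) Encoding: $H\big(X_n\mid (g_k:k\in\mathcal Z_n),(Q_{\mathcal V}: n\in\mathcal V)\big)=0$ for all $n\in[N]$. (ii) Decodability: $H\big(\sum_{k\in[K]}g_k\mid (X_n:n\in\mathcal U)\big)=0$ for all $\mathcal U\in\binom{[N]}{N_r}$. (iii) Security: $I\big(X_1,\dots,X_N;g_1,\dots,g_K\mid \sum_{k\in[K]}g_k\big)=0$. The communication cost of the scheme is $\max_{n\in[N]}|X_n|/L$. A value $R$ is achievable (for a given data assignment) if there exist a block length $L$ (which may be taken as large as needed) and a secure gradient coding scheme with block length $L$ whose communication cost equals $R$. *)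

(* Defs.v *)
From HB Require Import structures.
From mathcomp Require Import all_boot all_order all_algebra.
From mathcomp Require Import reals exp.

Set Implicit Arguments.
Unset Strict Implicit.
Unset Printing Implicit Defensive.

Import Order.TTheory GRing.Theory Num.Theory.
Local Open Scope ring_scope.

(* Discrete random variables are maps X : Om -> T from a finite sample space
   Om carrying a probability mass function P to a finite alphabet T. *)

Section Entropy.
Variables (R : realType) (Om : finType) (P : Om -> R).

Definition is_pmf : Prop := (forall w, 0 <= P w) /\ \sum_w P w = 1.

Definition prob (A : pred Om) : R := \sum_(w | A w) P w.

Definition pmf_of (T : finType) (X : Om -> T) (x : T) : R :=
  prob (fun w => X w == x).

Definition rv_pair (T U : finType) (X : Om -> T) (Y : Om -> U) : Om -> T * U :=
  fun w => (X w, Y w).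

(* A family of random variables, whose alphabets may differ, seen as a single
   random variable.  A subfamily is the tuple over a subtype of the index
   type. *)
Definition rv_tuple (I : finType) (T : I -> finType)
    (X : forall i, Om -> T i) : Om -> {dffun forall i : I, T i} :=
  fun w => [ffun i => X i w].

(* Entropies are in base q.  The conventions 0 log 0 = 0 and
   0 log (0 / 0) = 0 hold because of the factor 0. *)
Variable q : nat.

Definition logq (x : R) : R := ln x / ln q%:R.

Definition entropy (T : finType) (X : Om -> T) : R :=
  - \sum_(x : T) pmf_of X x * logq (pmf_of X x).

Definition cond_entropy (T U : finType) (X : Om -> T) (Y : Om -> U) : R :=
  - \sum_(x : T) \sum_(y : U)
      pmf_of (rv_pair X Y) (x, y) *
        logq (pmf_of (rv_pair X Y) (x, y) / pmf_of Y y).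

Definition cond_mutual_info (T U V : finType)
    (X : Om -> T) (Y : Om -> U) (Z : Om -> V) : R :=
  cond_entropy X Z - cond_entropy X (rv_pair Y Z).

Definition iid_uniform (F : finFieldType) (L : nat)
    (g : Om -> 'rV[F]_L) : Prop :=
  (forall (j : 'I_L) (a : F),
     prob (fun w => g w ord0 j == a) = #|F|%:R^-1) /\
  (forall v : 'rV[F]_L,
     prob (fun w => [forall j, g w ord0 j == v ord0 j]) =
     \prod_(j < L) prob (fun w => g w ord0 j == v ord0 j)).

End Entropy.

(* Servers and datasets are numbered from 0. *)

Definition held_datasets (K N : nat) (D : 'I_K -> {set 'I_N}) (n : 'I_N) :
  {set 'I_K} := [set k | n \in D k].

Definition key_group (N S : nat) : finType :=
  {V : {set 'I_N} | #|V| == S}.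

Record scheme (R : realType) (F : finFieldType) (K N Nr S : nat)
    (D : 'I_K -> {set 'I_N}) (L : nat) := Scheme {
  space : finType;
  pmf : space -> R;
  pmfP : is_pmf pmf;
  grad : 'I_K -> space -> 'rV[F]_L;
  key_alphabet : key_group N S -> finType;
  key : forall V : key_group N S, space -> key_alphabet V;
  msg_len : 'I_N -> nat;
  msg : forall n : 'I_N, space -> 'rV[F]_(msg_len n);
  grad_iid : forall k, iid_uniform pmf (grad k);
  (* Joint mutual independence of all keys and all gradients; in particular
     the gradients are mutually independent. *)
  independence :
    entropy pmf #|F| (rv_pair (rv_tuple key) (rv_tuple grad)) =
    \sum_V entropy pmf #|F| (key V) + \sum_k entropy pmf #|F| (grad k);
  encoding : forall n : 'I_N,
    cond_entropy pmf #|F| (msg n)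
      (rv_pair
         (rv_tuple (fun k : {k : 'I_K | k \in held_datasets D n} =>
            grad (val k)))
         (rv_tuple (fun V : {V : key_group N S | n \in val V} =>
            key (val V)))) = 0;
  decodability : forall U : {set 'I_N}, #|U| = Nr ->
    cond_entropy pmf #|F| (fun w => \sum_k grad k w)
      (rv_tuple (fun n : {n : 'I_N | n \in U} => msg (val n))) = 0;
  security :
    cond_mutual_info pmf #|F| (rv_tuple msg) (rv_tuple grad)
      (fun w => \sum_k grad k w) = 0
}.

Definition comm_cost (R : realType) (F : finFieldType) (K N Nr S : nat)
    (D : 'I_K -> {set 'I_N}) (L : nat) (s : scheme R F Nr S D L) : R :=
  (\max_(n < N) msg_len s n)%N%:R / L%:R.

Definition achievable (R : realType) (F : finFieldType) (K N Nr S : nat)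
    (D : 'I_K -> {set 'I_N}) (r : R) : Prop :=
  exists L : nat, (0 < L)%N /\
    exists s : scheme R F Nr S D L, comm_cost s = r.

(* Main.v *)
Require Import Defs.
From HB Require Import structures.
From mathcomp Require Import all_boot all_order all_algebra.
From mathcomp Require Import all_fingroup all_solvable all_field.
From mathcomp Require Import zify ring.
From mathcomp Require Import reals exp.

Set Implicit Arguments.
Unset Strict Implicit.
Unset Printing Implicit Defensive.

Import Order.TTheory GRing.Theory Num.Theory.
Import VectorInternalTheory.
Local Open Scope ring_scope.

(** Server [n] sends row [n] of a word of an MDS code [C] with [N] rows of [a]
    symbols, over a large extension of [F]; any [Nr] rows determine the word.
    Each key [Q_V] multiplies [r] words of [C] supported on the rows [V], and
    [Ks] denotes the span of all these key words.  Suppose that [Ks] projects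
    onto [a * (N - M)] dimensions on every window [W] of [N - M] rows.  Then
    any word of [C] can be corrected by an element of [Ks] so as to vanish on
    [W]: every gradient can be encoded on the servers that hold it, modulo [Ks]
    the sent word depends only on the sum of the gradients, and the uniform
    keys hide the rest.  The cost is then
    [a / (a * Nr - r * 'C(N, S))] with [a = N! ('C(N, S) - 'C(M, S))] and
    [r = N! (N - M)].

    For these values exactly [a * (N - M)] key words meet a given window, so
    they must be independent there.  By a simultaneous form of Rado's theorem
    on independent transversals, generic key words have this property as soon
    as, for every family [J] of [S]-sets that meet [W], the words supported on
    the members of [J] span at least [r * #|J|] dimensions on [W].  Both sides
    are invariant under the permutations of the servers that preserve [W],
    because [C] is made symmetric by stacking Reed-Solomon codes with all
    permutations of the evaluation points; and the left-hand side is
    submodular.  Uncrossing thus reduces the inequality to invariant families,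
    for which it follows from the MDS property. *)

(** * Entropies of uniform and of determined variables *)

Section Information.
Variables (R : realType) (Om : finType) (P : Om -> R) (q : nat).
Hypothesis P_pmf : is_pmf P.

Lemma pmf_ofE (T : finType) (X : Om -> T) x :
  pmf_of P X x = prob P (fun w => X w == x).
Proof. by []. Qed.

Lemma pmf_pairE (T U : finType) (X : Om -> T) (Y : Om -> U) x y :
  pmf_of P (rv_pair X Y) (x, y) = prob P (fun w => (X w == x) && (Y w == y)).
Proof. by []. Qed.

Lemma sum_prob (T : finType) (X : Om -> T) (B : pred Om) :
  \sum_x prob P (fun w => (X w == x) && B w) = prob P B.
Proof.
rewrite /prob [RHS](partition_big X xpredT) //=; apply: eq_bigr => x _.
by apply: eq_bigl => w; rewrite andbC.
Qed.

Lemma pmf_of_sum1 (T : finType) (X : Om -> T) : \sum_x pmf_of P X x = 1.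
Proof.
rewrite -P_pmf.2 -/(prob P xpredT) -(sum_prob X).
by apply: eq_bigr => x _; apply: eq_bigl => w; rewrite andbT.
Qed.

(** If [x] and [y] occur together, the event [Y = y] lies inside [X = x], so the quotient in the
    logarithm is 1, unless the term has the factor 0. *)
Lemma cond_entropy_determined (T U : finType) (X : Om -> T) (Y : Om -> U) :
  (forall w w', Y w = Y w' -> X w = X w') -> cond_entropy P q X Y = 0.
Proof.
move=> XY; rewrite /cond_entropy big1 ?oppr0 // => x _.
rewrite big1 // => y _; rewrite pmf_pairE pmf_ofE.
have [/existsP[w0 /andP[/eqP Xw0 /eqP Yw0]]|noW] :=
  boolP [exists w, (X w == x) && (Y w == y)].
  rewrite (_ : prob P _ = prob P (fun w => Y w == y)); last first.
    apply: eq_bigl => w; have [Yw|] := eqVneq (Y w) y; last by rewrite andbF.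
    by rewrite (XY w w0) ?Xw0 ?eqxx // Yw Yw0.
  have [->|pn0] := eqVneq (prob P (fun w => Y w == y)) 0; first by rewrite mul0r.
  by rewrite divff // /logq ln1 mul0r mulr0.
rewrite {1}/prob big_pred0 ?mul0r // => w; apply/negbTE; apply: contra noW => h.
by apply/existsP; exists w.
Qed.

(** Here [phi] is the conditional law of [X] given [(Y, Z)]. Summing over [y] shows that it is also
    the law given [Z], so both conditional entropies are one and the same sum. *)
Lemma cond_mutual_info_eq0 (T U V : finType)
    (X : Om -> T) (Y : Om -> U) (Z : Om -> V) (phi : T -> V -> R) :
    (forall x y z, prob P (fun w => [&& X w == x, Y w == y & Z w == z]) =
       phi x z * prob P (fun w => (Y w == y) && (Z w == z))) ->
  cond_mutual_info P q X Y Z = 0.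
Proof.
move=> Hphi.
have HZ x z : prob P (fun w => (X w == x) && (Z w == z)) =
              phi x z * prob P (fun w => Z w == z).
  rewrite -(sum_prob Y) -[in RHS](sum_prob Y) mulr_sumr; apply: eq_bigr => y _.
  by rewrite -Hphi; apply: eq_bigl => w; rewrite andbCA.
rewrite /cond_mutual_info /cond_entropy; apply/eqP; rewrite subr_eq0; apply/eqP.
congr (- _); apply: eq_bigr => x _.
transitivity (\sum_z \sum_y
    prob P (fun w => [&& X w == x, Y w == y & Z w == z]) * logq q (phi x z)).
  apply: eq_bigr => z _; rewrite -mulr_suml pmf_pairE pmf_ofE.
  rewrite (_ : \sum_y _ = prob P (fun w => (X w == x) && (Z w == z))).
    rewrite HZ; have [->|pn0] := eqVneq (prob P (fun w => Z w == z)) 0.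
      by rewrite mulr0 !mul0r.
    by rewrite mulfK.
  by rewrite -[RHS](sum_prob Y); apply: eq_bigr => y _; apply: eq_bigl => w;
    rewrite andbCA.
rewrite exchange_big /= pair_big /=; apply: eq_bigr => -[y z] _ /=.
have -> : pmf_of P (rv_pair X (rv_pair Y Z)) (x, (y, z)) =
    phi x z * pmf_of P (rv_pair Y Z) (y, z) by rewrite -Hphi.
rewrite Hphi pmf_pairE; set p := prob _ _.
by have [->|pn0] := eqVneq p 0; rewrite ?mulr0 ?mul0r // mulfK.
Qed.

End Information.

Section Uniform.
Variables (R : realType) (Om : finType) (q : nat).
Hypothesis Om_gt0 : (0 < #|Om|)%N.

Definition uniform (w : Om) : R := #|Om|%:R^-1.

Lemma uniform_pmf : is_pmf uniform.
Proof.
split=> [w|]; first by rewrite invr_ge0 ler0n.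
by rewrite sumr_const -(mulr_natl _ #|_|) divff // pnatr_eq0 -lt0n.
Qed.

Lemma prob_uniform (A : pred Om) : prob uniform A = #|A|%:R / #|Om|%:R.
Proof. by rewrite /prob (eq_bigl (mem A)) // sumr_const -[LHS]mulr_natl. Qed.

Lemma prob_uniform_inj (A B : pred Om) (h : Om -> Om) : injective h ->
  (forall w, A w -> B (h w)) -> prob uniform A <= prob uniform B.
Proof.
move=> inj_h AB; rewrite !prob_uniform ler_wpM2r ?invr_ge0 ?ler0n // ler_nat.
rewrite -(card_image inj_h); apply: subset_leq_card; apply/subsetP => w'.
by case/imageP => w Aw ->; apply: AB.
Qed.

(** The maps [h] inject each fibre of [X] into any other one, so all fibres have equal size. *)
Lemma pmf_uniform (T : finType) (X : Om -> T) :
    (forall x x', exists2 h : Om -> Om, injective h &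
       forall w, X w = x -> X (h w) = x') ->
  forall x, pmf_of uniform X x = #|T|%:R^-1.
Proof.
move=> homX x; have pXx x' : pmf_of uniform X x' = pmf_of uniform X x.
  apply/eqP; rewrite eq_le !pmf_ofE; apply/andP; split.
    have [h inj_h Xh] := homX x' x; apply: (prob_uniform_inj inj_h) => w.
    by move/eqP/Xh/eqP.
  have [h inj_h Xh] := homX x x'; apply: (prob_uniform_inj inj_h) => w.
  by move/eqP/Xh/eqP.
have := pmf_of_sum1 uniform_pmf X; under eq_bigr do rewrite pXx.
rewrite sumr_const -(mulr_natl _ #|_|) => T1.
have Tn0 : #|T|%:R != 0 :> R.
  by apply/eqP => T0; move/eqP: T1; rewrite T0 mul0r eq_sym oner_eq0.
by apply: (mulfI Tn0); rewrite T1 divff.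
Qed.

Lemma entropy_uniform (T : finType) (X : Om -> T) :
    (forall x, pmf_of uniform X x = #|T|%:R^-1) ->
  entropy uniform q X = logq q #|T|%:R.
Proof.
move=> pX; rewrite /entropy; under eq_bigr do rewrite pX.
(* An empty alphabet gives 0 on both sides, since [ln 0 = 0]. *)
have [T0|T_gt0] := posnP #|T|.
  rewrite T0 invr0 big1 => [|x _]; last by rewrite mul0r.
  by rewrite oppr0 /logq ln0 ?mul0r.
have Tn0 : #|T|%:R != 0 :> R by rewrite pnatr_eq0 -lt0n.
rewrite sumr_const -(mulr_natl _ #|_|) mulrA divff // mul1r /logq lnV ?posrE ?ltr0n //.
by rewrite mulNr opprK.
Qed.

End Uniform.

Lemma logqX (R : realType) (q n m : nat) : (0 < n)%N ->
  logq q (n ^ m)%:R = m%:R * logq q n%:R :> R.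
Proof.
move=> n0; rewrite /logq natrX -powR_mulrn ?ler0n // ln_powR //.
by rewrite mulrA.
Qed.

(** Translation by a constant row makes each entry uniform; the product of the [L] marginals is then
    the mass of a row. *)
Lemma iid_uniform_of_uniform (R : realType) (Om : finType) (P : Om -> R)
    (F : finFieldType) (L : nat) (g : Om -> 'rV[F]_L) : 
    is_pmf P -> (forall v, pmf_of P g v = #|{: 'rV[F]_L}|%:R^-1) ->
  iid_uniform P g.
Proof.
move=> P_pmf g_unif.
have q_gt0 : (0 < #|F|)%N by apply/card_gt0P; exists 0.
have qn0 : #|F|%:R != 0 :> R by rewrite pnatr_eq0 -lt0n.
have coord (j : 'I_L) (a : F) :
    prob P (fun w => g w ord0 j == a) = #|F|%:R^-1.
  have probE b : prob P (fun w => g w ord0 j == b) =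
      #|[set v : 'rV[F]_L | v ord0 j == b]|%:R / #|{: 'rV[F]_L}|%:R.
    rewrite -(sum_prob P g) (bigID (fun v : 'rV[F]_L => v ord0 j == b)) /=.
    rewrite [X in _ + X]big1 ?addr0 => [|v vjb]; last first.
      rewrite /prob big_pred0 // => w; apply/negbTE/negP => /andP[/eqP-> vb].
      by rewrite vb in vjb.
    rewrite -sum1dep_card natr_sum mulr_suml.
    apply: eq_bigr => v /eqP vjb; rewrite mul1r -(g_unif v).
    apply: eq_bigl => w; have [->|] := eqVneq (g w) v; last by [].
    by rewrite vjb eqxx.
  have shift b c : (#|[set v : 'rV[F]_L | v ord0 j == b]| <=
                   #|[set v : 'rV[F]_L | v ord0 j == c]|)%N.
    rewrite -(card_imset _ (addIr (const_mx (c - b)))).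
    apply/subset_leq_card/subsetP => v' /imsetP[v]; rewrite !inE => /eqP vb ->.
    by rewrite !mxE vb addrC subrK.
  have probEq b : prob P (fun w => g w ord0 j == b) =
      prob P (fun w => g w ord0 j == a).
    by rewrite !probE; congr (_%:R / _); apply/eqP; rewrite eqn_leq !shift.
  have := pmf_of_sum1 P_pmf (fun w => g w ord0 j).
  under eq_bigr do rewrite pmf_ofE probEq.
  rewrite sumr_const -(mulr_natl _ #|_|) => q1.
  by apply: (mulfI qn0); rewrite q1 divff.
split=> // v; under [RHS]eq_bigr do rewrite coord.
rewrite prodr_const card_ord exprVn -natrX -[L in RHS]mul1n -card_mx -(g_unif v).
apply: eq_bigl => w; apply/forallP/eqP => [gv|-> //].
by apply/rowP => j; apply/eqP.
Qed.

(** With keys and gradients uniform on a product space, encoding and decodability become functional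
    dependence, and security becomes a translation of the keys that hides the passage from [g] to
    [g']. *)
Lemma scheme_of_messages (R : realType) (F : finFieldType) (K N Nr S : nat)
    (D : 'I_K -> {set 'I_N}) (L d m : nat)
    (X : {ffun key_group N S -> 'rV[F]_d} * {ffun 'I_K -> 'rV[F]_L} ->
         'I_N -> 'rV[F]_m) :
    (0 < K)%N ->
    (forall n (w w' : {ffun key_group N S -> 'rV[F]_d} * {ffun 'I_K -> 'rV[F]_L}),
       (forall k, n \in D k -> w.2 k = w'.2 k) ->
       (forall V : key_group N S, n \in val V -> w.1 V = w'.1 V) ->
       X w n = X w' n) ->
    (forall (U : {set 'I_N})
       (w w' : {ffun key_group N S -> 'rV[F]_d} * {ffun 'I_K -> 'rV[F]_L}), #|U| = Nr ->
       (forall n, n \in U -> X w n = X w' n) ->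
       \sum_k w.2 k = \sum_k w'.2 k) ->
    (forall g g' : {ffun 'I_K -> 'rV[F]_L}, \sum_k g k = \sum_k g' k ->
       exists q0 : {ffun key_group N S -> 'rV[F]_d}, forall q, X (q, g) = X (q + q0, g')) ->
  exists s : scheme R F Nr S D L, forall n, msg_len s n = m.
Proof.
move=> K_gt0 X_enc X_dec X_sec.
pose Om : finType := ({ffun key_group N S -> 'rV[F]_d} * {ffun 'I_K -> 'rV[F]_L})%type.
have Om_gt0 : (0 < #|Om|)%N by apply/card_gt0P; exists (0, 0).
pose P := @uniform R Om.
have P_pmf : is_pmf P by exact: uniform_pmf.
pose key (V : key_group N S) (w : Om) := w.1 V.
pose grad k (w : Om) := w.2 k.
have shift_inj (w0 : Om) : injective (fun w : Om => (w.1 + w0.1, w.2 + w0.2) : Om).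
  by move=> [a b] [a' b'] /= [/addIr-> /addIr->].
have key_unif V x : pmf_of P (key V) x = #|{: 'rV[F]_d}|%:R^-1.
  apply: pmf_uniform => // y y'.
  exists (fun w => (w.1 + [ffun=> y' - y], w.2 + 0) : Om).
    exact: (shift_inj (_, _)).
  by rewrite /key => w /= <-; rewrite !ffunE addrC subrK.
have grad_unif k x : pmf_of P (grad k) x = #|{: 'rV[F]_L}|%:R^-1.
  apply: pmf_uniform => // y y'.
  exists (fun w => (w.1 + 0, w.2 + [ffun=> y' - y]) : Om).
    exact: (shift_inj (_, _)).
  by rewrite /grad => w /= <-; rewrite !ffunE addrC subrK.
have Hiid k : iid_uniform P (grad k).
  by apply: iid_uniform_of_uniform => // v; rewrite grad_unif.
have Hind : entropy P #|F| (rv_pair (rv_tuple key) (rv_tuple grad)) =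
    \sum_V entropy P #|F| (key V) + \sum_k entropy P #|F| (grad k).
  rewrite entropy_uniform; last first.
    apply: pmf_uniform => // -[y1 y2] [z1 z2].
    exists (fun w => (w.1 + [ffun i => z1 i - y1 i], w.2 + [ffun i => z2 i - y2 i]) : Om).
      exact: (shift_inj (_, _)).
    rewrite /rv_pair /rv_tuple /key /grad => w [<- <-] /=.
    by congr (_, _); apply/ffunP => i; rewrite !ffunE addrC subrK.
  under eq_bigr do rewrite (entropy_uniform #|F| (key_unif _)).
  under [X in _ = _ + X]eq_bigr do rewrite (entropy_uniform #|F| (grad_unif _)).
  rewrite card_prod [#|{dffun _}|]card_ffun [#|{dffun forall _ : 'I_K, _}|]card_ffun.
  have gt0 n : (0 < #|{: 'rV[F]_n}|)%N by apply/card_gt0P; exists 0.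
  rewrite natrM /logq lnM ?posrE ?ltr0n ?expn_gt0 ?gt0 // mulrDl -!/(logq _ _).
  by rewrite !logqX ?gt0 // !sumr_const !mulr_natl.
pose msg (n : 'I_N) (w : Om) := X w n.
have Henc n : cond_entropy P #|F| (msg n)
      (rv_pair
         (rv_tuple (fun k : {k : 'I_K | k \in held_datasets D n} => grad (val k)))
         (rv_tuple (fun V : {V : key_group N S | n \in val V} => key (val V)))) = 0.
  apply: cond_entropy_determined => w w' [/ffunP gE /ffunP kE].
  apply: X_enc => [k nk|V nV].
    have kn : k \in held_datasets D n by rewrite inE.
    by have := gE (exist _ k kn); rewrite !ffunE.
  by have := kE (exist _ V nV); rewrite !ffunE.
have Hdec (U : {set 'I_N}) : #|U| = Nr ->
    cond_entropy P #|F| (fun w => \sum_k grad k w)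
      (rv_tuple (fun n : {n : 'I_N | n \in U} => msg (val n))) = 0.
  move=> cU; apply: cond_entropy_determined => w w' /ffunP mE.
  apply: (X_dec U) => // n nU.
  by have := mE (exist _ n nU); rewrite !ffunE.
have Hsec : cond_mutual_info P #|F| (rv_tuple msg) (rv_tuple grad)
      (fun w => \sum_k grad k w) = 0.
  pose k0 := Ordinal K_gt0.
  (* A representative of the gradients with sum [z]: dataset [k0] carries everything. *)
  pose gz z : {ffun 'I_K -> 'rV[F]_L} := [ffun k => if k == k0 then z else 0].
  have sum_gz z : \sum_k gz z k = z.
    rewrite (bigD1 k0) //= ffunE eqxx big1 ?addr0 // => k /negbTE kk0.
    by rewrite ffunE kk0.
  (* Counts the keys that yield the messages [x]. Translation by [q0] is a bijection, so only the
     sum of [g] matters, and [count] divided by the number of keys is the required kernel. *)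
  pose count (x : {ffun 'I_N -> 'rV[F]_m}) (g : {ffun 'I_K -> 'rV[F]_L}) := #|[pred q | [forall n, X (q, g) n == x n]]|.
  have count_eq (x : {ffun 'I_N -> 'rV[F]_m}) (g g' : {ffun 'I_K -> 'rV[F]_L}) :
      \sum_k g k = \sum_k g' k -> count x g = count x g'.
    move=> /X_sec[q0 Xq0]; rewrite /count -!sum1_card.
    rewrite [RHS](reindex_inj (addIr q0)) /=; apply: eq_bigl => q.
    by rewrite !inE Xq0.
  have card_fiber (A : pred {ffun key_group N S -> 'rV[F]_d}) (y : {ffun 'I_K -> 'rV[F]_L}) :
      #|[pred w : Om | A w.1 & w.2 == y]| = #|A|.
    have inj_pair : injective (fun q => (q, y) : Om) by move=> q q' [].
    rewrite -(card_imset A inj_pair).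
    apply: eq_card => -[q g]; rewrite !inE /=; apply/andP/imsetP => [[Aq /eqP->]|[q' Aq' [-> ->]]].
      by exists q.
    by [].
  apply: (@cond_mutual_info_eq0 R Om P #|F| _ _ _ (rv_tuple msg) (rv_tuple grad) _
    (fun x z => (count x (gz z))%:R / #|{ffun key_group N S -> 'rV[F]_d}|%:R)) => x y z.
  rewrite !prob_uniform.
  have gradE (w : Om) : (rv_tuple grad w == y) = (w.2 == y).
    by apply/eqP/eqP => [<-|wy]; apply/ffunP => k; rewrite ffunE // /grad wy.
  have sum_gradE (w : Om) : \sum_k grad k w = \sum_k w.2 k by [].
  have [yz|yz] := eqVneq (\sum_k y k) z; last first.
    have no_w (w : Om) : (rv_tuple grad w == y) && (\sum_k grad k w == z) = false.
      rewrite gradE sum_gradE; apply/negP => /andP[/eqP-> yz'].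
      by rewrite yz' in yz.
    rewrite (_ : #|_| = 0%N) ?mul0r; last by apply: eq_card0 => w; rewrite unfold_in no_w andbF.
    by rewrite (_ : #|_| = 0%N) ?mul0r ?mulr0 //; apply: eq_card0 => w; rewrite unfold_in no_w.
  have -> : #|[pred w : Om | [&& rv_tuple msg w == x, rv_tuple grad w == y
                             & \sum_k grad k w == z]]| = count x (gz z).
    rewrite -(count_eq x y) ?sum_gz // /count -(card_fiber _ y); apply: eq_card => w.
    rewrite !inE gradE sum_gradE; have [wy|_] := eqVneq w.2 y; last by rewrite !andbF.
    rewrite wy yz eqxx !andbT; apply/eqP/forallP => [<- n|Xx].
      by rewrite ffunE /msg [w]surjective_pairing wy.
    by apply/ffunP => n; rewrite ffunE /msg [w]surjective_pairing wy; apply/eqP.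
  have -> : #|[pred w : Om | (rv_tuple grad w == y) && (\sum_k grad k w == z)]| =
            #|{ffun key_group N S -> 'rV[F]_d}|.
    rewrite -(card_fiber xpredT y); apply: eq_card => w.
    rewrite !inE gradE sum_gradE; have [wy|_] := eqVneq w.2 y; last by [].
    by rewrite wy yz eqxx.
  rewrite mulrA divfK // pnatr_eq0 -lt0n; apply/card_gt0P; by exists 0.
by exists (Scheme P_pmf Hiid Hind Henc Hdec Hsec).
Qed.

(** * Generic independent vectors and uncrossing *)

Section GenericVectors.
Variables (K : fieldType) (vT : vectType K).

(** Take [x] outside [Zs] by induction, and [y] in [Y] outside [Z]. Each member of [Z :: Zs]
    contains [c *: x + y] for at most one [c], and [s] has more scalars than there are members. *)
Lemma avoid_subspaces (s : seq K) (Y : {vspace vT}) (Zs : seq {vspace vT}) :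
    uniq s -> (size Zs < size s)%N -> all (fun Z => ~~ (Y <= Z)%VS) Zs ->
  exists2 x, x \in Y & all (fun Z : {vspace vT} => x \notin Z) Zs.
Proof.
move=> Us; elim: Zs => [|Z Zs IH] sz_s; first by exists 0; rewrite ?mem0v.
case/andP=> /subvPn[y Yy Z'y] /IH[|x Yx Zs'x]; first exact: ltnW.
pose f c := find (fun Z' : {vspace vT} => c *: x + y \in Z') (Z :: Zs).
have [/hasP[c _ fc]|f_small] := boolP (has (fun c => f c == size (Z :: Zs)) s).
  exists (c *: x + y); first by rewrite memvD ?memvZ.
  apply/allP => Z' Z'in; apply/negP => cZ'.
  have: has (fun Z' : {vspace vT} => c *: x + y \in Z') (Z :: Zs).
    by apply/hasP; exists Z'.
  by rewrite has_find ltn_neqAle -/(f c) fc.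
suff: (size s <= size (Z :: Zs))%N by rewrite leqNgt sz_s.
have f_lt c : c \in s -> (f c < size (Z :: Zs))%N.
  move=> sc; rewrite ltn_neqAle find_size andbT.
  by apply: contra f_small => fc; apply/hasP; exists c.
rewrite -(size_map f) -[leqRHS](size_iota 0); apply: uniq_leq_size; last first.
  by move=> _ /mapP[c sc ->]; rewrite mem_iota /= f_lt.
rewrite map_inj_in_uniq // => c c' sc sc' fcc'; apply/eqP.
have nthP b : b \in s -> b *: x + y \in nth 0%VS (Z :: Zs) (f b).
  move=> sb; apply: (@nth_find _ 0%VS (fun Z' : {vspace vT} => b *: x + y \in Z')).
  by rewrite has_find f_lt.
have := nthP c' sc'; have := nthP c sc; rewrite -fcc'.
(* Two scalars with the same index put [x] into that subspace; for [Z] this puts [y] there too. *)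
have := f_lt c sc; case: (f c) => [|k] /= lt_k cZ c'Z.
  apply: contraNT Z'y; rewrite -subr_eq0 => cc'.
  have: (c - c')^-1 *: ((c *: x + y) - (c' *: x + y)) \in Z.
    by rewrite memvZ ?memvB.
  rewrite opprD addrACA subrr addr0 -scalerBl scalerA mulVf // scale1r => Zx.
  by rewrite rpredDl ?memvZ in cZ.
have: nth 0%VS Zs k \in Zs by rewrite mem_nth.
move/(allP Zs'x); apply: contraNT; rewrite -subr_eq0 => cc'.
have: (c - c')^-1 *: ((c *: x + y) - (c' *: x + y)) \in nth 0%VS Zs k.
  by rewrite memvZ ?memvB.
by rewrite opprD addrACA subrr addr0 -scalerBl scalerA mulVf // scale1r.
Qed.

Section Rado.
Variables (s : seq K) (I T : finType).
Hypotheses (Us : uniq s) (sz_s : (#|{: T * {set I}}| < size s)%N).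
Variables (N : T -> {vspace vT}) (A : T -> {set I}).

(** When the [Y i] are lines, this says that those of [A t] are independent modulo [N t], for all
    [t] at once. *)
Definition rado_condition (Y : I -> {vspace vT}) :=
  forall t (J : {set I}), J \subset A t ->
    (\dim (N t) + #|J| <= \dim (N t + \sum_(i in J) Y i))%N.

(** A generic [x] avoids every [span (t, J)] that does not contain [Y i0]. *)
Lemma rado_step (Y : I -> {vspace vT}) i0 : rado_condition Y ->
  exists2 x, x \in Y i0 &
    rado_condition (fun i => if i == i0 then <[x]>%VS else Y i).
Proof.
move=> condY; pose span (p : T * {set I}) :=
  (N p.1 + \sum_(i in p.2 :\ i0) Y i)%VS.
pose Zs := [seq span p | p <- enum {: T * {set I}} & ~~ (Y i0 <= span p)%VS].
have [||x Yx Zs'x] := @avoid_subspaces s (Y i0) Zs Us.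
- apply: leq_ltn_trans sz_s; rewrite size_map cardT size_filter.
  exact: count_size.
- by apply/allP => _ /mapP[p + ->]; rewrite mem_filter => /andP[].
exists x => // t J sJA.
have [Ji0|Ji0] := boolP (i0 \in J); last first.
  rewrite (eq_bigr Y) ?condY // => i Ji; case: eqP => // ii0.
  by rewrite -ii0 Ji in Ji0.
rewrite (big_setD1 i0) //= eqxx (eq_bigr Y) => [|i]; last first.
  by rewrite !inE => /andP[/negbTE->].
rewrite [(<[x]> + _)%VS]addvC addvA -/(span (t, J)).
have := condY t (J :\ i0) (subset_trans (subD1set _ _) sJA).
rewrite -/(span (t, J)) (cardsD1 i0 J) Ji0 add1n addnS.
(* If the bound for [J :\ i0] is strict, the span alone suffices. If it is tight, the condition for
   [J] keeps [Y i0] out of the span, and [x] adds a dimension. *)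
rewrite leq_eqVlt => /orP[/eqP dim_span|lt_span]; last first.
  by apply: leq_trans lt_span _; rewrite dimvS ?addvSl.
have Y_span : ~~ (Y i0 <= span (t, J))%VS.
  apply/negP => Ysub; have := condY t J sJA.
  rewrite (big_setD1 i0) //= [(Y i0 + _)%VS]addvC addvA (addv_idPl Ysub) -dim_span.
  by rewrite (cardsD1 i0 J) Ji0 add1n addnS ltnn.
have : x \notin span (t, J).
  apply: (allP Zs'x); apply/mapP; exists (t, J) => //.
  by rewrite mem_filter Y_span mem_enum.
move=> xspan; rewrite dim_span.
rewrite (ltn_leqif (dimv_leqif_sup (addvSl _ _))) subv_add subvv /=.
by rewrite -memvE.
Qed.

Theorem rado (Y : I -> {vspace vT}) : rado_condition Y ->
  exists y : I -> vT, (forall i, y i \in Y i) /\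
    rado_condition (fun i => <[y i]>%VS).
Proof.
move=> condY.
have step (r : seq I) : exists2 y : I -> vT, (forall i, y i \in Y i) &
    rado_condition (fun i => if i \in r then <[y i]>%VS else Y i).
  elim: r => [|i0 r [y Yy condr]]; first by exists (fun=> 0) => // i; apply: mem0v.
  have [r_i0|r'i0] := boolP (i0 \in r).
    exists y => // t J sJ; rewrite (leq_trans (condr t J sJ)) // dimvS //.
    rewrite addvS // [X in (_ <= X)%VS](eq_bigr (fun i => if i \in r then <[y i]>%VS else Y i)) //.
    by move=> i _; rewrite inE; case: eqP => // ->; rewrite r_i0.
  have [x] := rado_step i0 condr; rewrite (negbTE r'i0) => Yx condx.
  exists (fun i => if i == i0 then x else y i) => [i|t J sJ].
    by case: eqP => [->|].
  rewrite (leq_trans (condx t J sJ)) // dimvS // addvS //.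
  rewrite [X in (_ <= X)%VS](eq_bigr (fun i => if i == i0 then <[x]>%VS else
     if i \in r then <[y i]>%VS else Y i)) //.
  by move=> i _; rewrite inE; case: eqP.
have [y Yy condy] := step (enum I); exists y; split=> // t J sJ.
rewrite (leq_trans (condy t J sJ)) // dimvS // addvS //.
by rewrite [X in (X <= _)%VS](eq_bigr (fun i => <[y i]>%VS)) // => i _; rewrite mem_enum.
Qed.

End Rado.
End GenericVectors.

Section Uncrossing.
Local Open Scope nat_scope.
Variables (T : finType) (X : {set T}) (D : {set T} -> nat) (G : (T -> T) -> Prop).
Variables (r d : nat).
Hypothesis D_submod : forall A B : {set T}, D (A :|: B) + D (A :&: B) <= D A + D B.
Hypothesis G_inj : forall f, G f -> injective f.
Hypothesis G_X : forall f, G f -> f @: X \subset X.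
Hypothesis G_D : forall f (A : {set T}), G f -> D (f @: A) = D A.

(** Among the minimisers of [D A - r * #|A|] take a largest one. Its image under [f] is a minimiser
    too, by submodularity so is the union of both, and maximality makes [A] invariant. The bound for
    [A] then implies all others. *)
Lemma uncrossing :
    (forall A : {set T}, A \subset X -> (forall f, G f -> f @: A \subset A) ->
       d + r * #|A| <= D A) ->
  forall A : {set T}, A \subset X -> d + r * #|A| <= D A.
Proof.
move=> D_inv.
(* Up to a constant, [h] is [D A - r * #|A|]; [cost] orders lexicographically by [h], then by the
   size of the complement. *)
pose h (A : {set T}) := D A + r * #|~: A|.
pose cost A := h A * #|T|.+1 + #|~: A|.
have hE A : h A = cost A %/ #|T|.+1.
  by rewrite divnMDl // divn_small ?addn0 // ltnS max_card.
have [A sAX A_min] : exists2 A : {set T}, A \subset X &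
    forall B : {set T}, B \subset X -> cost A <= cost B.
  case: (arg_minnP (P := fun A : {set T} => A \subset X) cost (sub0set X)) => A sAX Amin.
  by exists A.
have h_min (B : {set T}) : B \subset X -> h A <= h B.
  by move=> sBX; rewrite !hE leq_div2r // A_min.
have A_inv f : G f -> f @: A \subset A.
  move=> Gf; set B := f @: A.
  have sBX : B \subset X by apply: subset_trans (imsetS _ sAX) (G_X Gf).
  have cB : #|~: B| = #|~: A|.
    by rewrite [LHS]cardsCs [RHS]cardsCs !setCK (card_imset _ (G_inj Gf)).
  have hB : h B = h A by rewrite /h G_D // cB.
  have sU : A :|: B \subset X by rewrite subUset sAX.
  have hI : h A <= h (A :&: B).
    by apply: h_min; apply: subset_trans (subsetIl _ _) sAX.
  have hUI : h (A :|: B) + h (A :&: B) <= h A + h B.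
    rewrite /h addnACA [leqRHS]addnACA leq_add ?D_submod // -!mulnDr leq_mul //.
    by rewrite setCU setCI addnC cardsUI.
  have hU : h (A :|: B) = h A.
    apply/eqP; rewrite eqn_leq h_min // andbT -(leq_add2r (h A)) -[X in _ <= _ + X]hB.
    by rewrite (leq_trans _ hUI) // leq_add2l.
  have := A_min _ sU; rewrite /cost hU leq_add2l.
  rewrite -(leq_add2r #|A|) addnC cardsC -(cardsC (A :|: B)) addnC leq_add2l => cU.
  have := subset_leqif_cards (subsetUl A B) => -[cAU eqAU].
  have : A == A :|: B by rewrite -eqAU eqn_leq cAU.
  by move/eqP->; apply: subsetUr.
move=> B /h_min; have := D_inv A sAX A_inv.
rewrite -(leq_add2r (r * #|~: A|)) -addnA -mulnDr cardsC => hA.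
move/(leq_trans hA); rewrite -(cardsC B) mulnDr addnA /h leq_add2r.
by [].
Qed.

End Uncrossing.

(** * Symmetric MDS codes *)

Section ZeroRows.
Variables (K : fieldType) (N a : nat).
Local Notation word := 'M[K]_(N, a).

Definition zeros (U : {set 'I_N}) : {vspace word} :=
  lker (linfun (rowsub (fun i : 'I_#|U| => enum_val i) : word -> 'M[K]_(#|U|, a))).

Lemma zerosP (U : {set 'I_N}) (X : word) :
  reflect (forall n c, n \in U -> X n c = 0) (X \in zeros U).
Proof.
rewrite memv_ker lfunE /=; apply: (iffP eqP) => [/matrixP X0 n c Un|X0].
  by have := X0 (enum_rank_in Un n) c; rewrite !mxE enum_rankK_in.
by apply/matrixP => i c; rewrite !mxE X0 ?enum_valP.
Qed.

Lemma dim_zeros (U : {set 'I_N}) :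
  (\dim (zeros U) + #|U| * a = \dim {: word})%N.
Proof.
set f := linfun (rowsub (fun i : 'I_#|U| => enum_val i) : word -> 'M[K]_(#|U|, a)).
rewrite -(limg_ker_dim f fullv) capfv; congr (_ + _)%N.
suff -> : limg f = fullv by rewrite dimvf dim_matrix.
apply/eqP; rewrite eqEsubv subvf; apply/subvP => Y _.
pose X : word := \matrix_(n, c) \sum_(i < #|U| | enum_val i == n) Y i c.
suff -> : Y = f X by rewrite memv_img ?memvf.
apply/matrixP => i c; rewrite lfunE /= !mxE (big_pred1 i) // => j.
by rewrite (inj_eq enum_val_inj).
Qed.

Lemma zerosS (U U' : {set 'I_N}) : U \subset U' -> (zeros U' <= zeros U)%VS.
Proof.
move=> /subsetP sUU'; apply/subvP => X /zerosP X0; apply/zerosP => n c /sUU'.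
exact: X0.
Qed.

End ZeroRows.

Section MDSCode.
Variables (K : fieldType) (N a s : nat).
Local Notation word := 'M[K]_(N, a).
Variable C : {vspace word}.

(** [s] is the redundancy per column. The first clause supplies words of small support in a single
    column; the second is the minimum distance, so any [N - s] rows determine a word. *)
Definition mds_code :=
  (forall (U : {set 'I_N}) n c, n \in U -> (s < #|U|)%N ->
    exists2 f : word, f \in C &
      f n c = 1 /\ forall n' c', (n' \notin U) || (c' != c) -> f n' c' = 0) /\
  (forall (U : {set 'I_N}) (X : word), (#|U| <= s)%N -> X \in C ->
    X \in zeros K a (~: U) -> X = 0).

(** The accompanying permutation of the columns does not affect which rows vanish. *)
Definition symmetric_code := forall sigma : 'S_N, exists rho : 'S_a,
  forall X : word, X \in C -> mxsub sigma rho X \in C.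

Definition supported (U : {set 'I_N}) : {vspace word} := (C :&: zeros K a (~: U))%VS.

Lemma supportedP (U : {set 'I_N}) (X : word) :
  reflect (X \in C /\ forall n c, n \notin U -> X n c = 0) (X \in supported U).
Proof.
rewrite memv_cap; apply: (iffP andP) => -[-> X0]; split=> //.
  by move=> n c Un; move/zerosP: X0 => ->; rewrite ?inE.
by apply/zerosP => n c; rewrite inE; apply: X0.
Qed.

Lemma supportedS (U U' : {set 'I_N}) :
  U \subset U' -> (supported U <= supported U')%VS.
Proof. by move=> sUU'; rewrite capvS // zerosS // setCS. Qed.

Hypothesis C_mds : mds_code.

Lemma mds_word (U : {set 'I_N}) n c : n \in U -> (s < #|U|)%N ->
  exists f : word, [/\ f \in supported U, f n c = 1 &
    forall n' c', c' != c -> f n' c' = 0].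
Proof.
move=> Un sU; have [f Cf [fnc f0]] := C_mds.1 U n c Un sU; exists f; split=> //.
  by apply/supportedP; split=> // n' c' Un'; rewrite f0 ?Un'.
by move=> n' c' cc'; rewrite f0 ?cc' ?orbT.
Qed.

(** For an entry [(n, c)] with [n] in [U0], the set [n |: (U :\: U0)] has more than [s] points, so
    it supports a word that is 1 there and 0 at all other entries of the rows [U0]. Such words
    interpolate anything on [U0]. *)
Lemma supported_onto (U U0 : {set 'I_N}) : U0 \subset U ->
  (s <= #|U :\: U0|)%N -> (supported U + zeros K a U0)%VS = fullv.
Proof.
move=> sU0U cU; apply/eqP; rewrite eqEsubv subvf; apply/subvP => X _.
have /fin_all_exists[F HF] (p : 'I_N * 'I_a) : exists f : word, p.1 \in U0 ->
    [/\ f \in supported (p.1 |: (U :\: U0)), f p.1 p.2 = 1 &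
    forall n' c', c' != p.2 -> f n' c' = 0].
  have [U0p|_] := boolP (p.1 \in U0); last by exists 0.
  have [||f Hf] := @mds_word (p.1 |: (U :\: U0)) p.1 p.2; first exact: setU11.
    by rewrite cardsU1 !inE U0p add1n ltnS.
  by exists f.
pose X1 := \sum_(p | p.1 \in U0) X p.1 p.2 *: F p.
rewrite -[X](subrK X1) addrC memv_add //.
  apply: memv_suml => p U0p; apply: memvZ; have [FY _ _] := HF p U0p.
  apply: subvP FY; apply: supportedS; apply/subsetP => n; rewrite !inE.
  by case/orP => [/eqP->|/andP[]//]; apply: (subsetP sU0U).
apply/zerosP => n c U0n; rewrite !mxE summxE (bigD1 (n, c)) //= mxE.
have [_ -> _] := HF (n, c) U0n; rewrite mulr1 big1 ?addr0 ?subrr // => -[n' c'].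
rewrite /= xpair_eqE => /andP[U0n' ne]; rewrite mxE.
have [FY _ F0] := HF (n', c') U0n'; have [cc'|cc'] := eqVneq c c'; last first.
  by rewrite F0 ?mulr0.
case/supportedP: FY => _ ->; rewrite ?mulr0 // !inE U0n /= orbF.
by move: ne; rewrite cc' eqxx andbT eq_sym.
Qed.

(** Row [n] is cleared entry by entry with words on [V]. *)
Lemma supported_add_point (U V : {set 'I_N}) n : n \in V -> V \subset U ->
  (s < #|V|)%N -> (supported U <= supported (U :\ n) + supported V)%VS.
Proof.
move=> Vn sVU sV; apply/subvP => X /supportedP[CX X0].
have /fin_all_exists[F HF] (c : 'I_a) := @mds_word V n c Vn sV.
pose X1 := \sum_c X n c *: F c.
have X1V : X1 \in supported V.
  by apply: memv_suml => c _; apply: memvZ; case: (HF c).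
rewrite -[X](subrK X1) memv_add //; apply/supportedP; split.
  by rewrite memvB //; case/supportedP: X1V.
move=> n' c; rewrite !inE negb_and negbK !mxE => n'U.
rewrite summxE (bigD1 c) //= mxE; have [FV Fnc F0] := HF c.
rewrite big1 ?addr0 => [|c' cc']; last first.
  by rewrite mxE; have [_ _ ->] := HF c'; rewrite ?mulr0 // eq_sym.
case/orP: n'U => [/eqP->|Un']; first by rewrite Fnc mulr1 subrr.
case/supportedP: FV => _ ->; first by rewrite X0 // mulr0 subrr.
by apply: contra Un'; apply: (subsetP sVU).
Qed.

Lemma dim_code_ge m : (m + s <= N)%N -> (m * a <= \dim C)%N.
Proof.
move=> msN.
have [U0 _ cU0] : exists2 U0 : {set 'I_N}, U0 \subset setT & #|U0| = m.
  have mN : (m <= #|[set: 'I_N]|)%N.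
    by rewrite cardsT card_ord (leq_trans _ msN) ?leq_addr.
  have : (0 < #|[set A : {set 'I_N} | A \subset setT & #|A| == m]|)%N.
    by rewrite cards_draws bin_gt0.
  by case/card_gt0P => A; rewrite inE => /andP[sA /eqP]; exists A.
have := @supported_onto setT U0 (subsetT _).
rewrite setTD cardsCs setCK card_ord cU0 leq_subRL; last first.
  by rewrite (leq_trans _ msN) ?leq_addr.
move=> /(_ msN) Cfull.
rewrite -cU0 -(leq_add2l (\dim (zeros K a U0))) dim_zeros -Cfull addnC.
apply: leq_trans (dimv_add_leqif _ _) _; rewrite leq_add2r dimvS //.
exact: capvSl.
Qed.

Hypothesis C_sym : symmetric_code.

(** * Dimensions spanned on a window of rows *)

Section Window.
Variable W : {set 'I_N}.

(* The rows in W of the words of J span a space of dimension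
   [window_dim J - \dim (zeros W)]. *)
Definition window_dim (J : {set {set 'I_N}}) : nat :=
  \dim (zeros K a W + \sum_(V in J) supported V).

(** These swaps generate the permutations of the servers that preserve [W]. *)
Definition swap_within (f : {set 'I_N} -> {set 'I_N}) : Prop :=
  exists x y : 'I_N, (x \in W) = (y \in W) /\ f = (fun V => tperm x y @: V).

Lemma window_dim_submod (A B : {set {set 'I_N}}) :
  (window_dim (A :|: B) + window_dim (A :&: B) <= window_dim A + window_dim B)%N.
Proof.
rewrite /window_dim -[leqRHS]dimv_sum_cap leq_add // dimvS //.
  rewrite subv_add; apply/andP; split.
    by apply: subv_trans (addvSl _ _); apply: addvSl.
  apply/subv_sumP => V; rewrite inE => /orP[AV|BV].
    apply: subv_trans (addvSl _ _); apply: subv_trans (addvSr _ _).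
    by rewrite (sumv_sup V).
  apply: subv_trans (addvSr _ _); apply: subv_trans (addvSr _ _).
  by rewrite (sumv_sup V).
rewrite subv_cap !addvS //; apply/subv_sumP => V; rewrite inE => /andP[AV BV].
  by rewrite (sumv_sup V).
by rewrite (sumv_sup V).
Qed.

Lemma swap_within_inj f : swap_within f -> injective f.
Proof.
by move=> [x [y [_ ->]]]; apply: imset_inj; apply: perm_inj.
Qed.

Lemma mem_tperm_imset (x y n : 'I_N) (V : {set 'I_N}) :
  (n \in tperm x y @: V) = (tperm x y n \in V).
Proof. by rewrite -{1}[n](tpermK x y) mem_imset //; apply: perm_inj. Qed.

(** Swapping the rows and permuting the columns accordingly is an injective linear map that
    preserves [zeros K a W] and carries [supported V] into [supported (f V)]. As [f] is an
    involution, one inequality suffices. *)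
Lemma window_dim_swap f (J : {set {set 'I_N}}) : swap_within f -> window_dim (f @: J) = window_dim J.
Proof.
move=> Gf; have [x [y [Wxy fE]]] := Gf; have f_inj := swap_within_inj Gf.
have ff V : f (f V) = V.
  by rewrite fE -imset_comp (eq_imset _ (tpermK x y)) imset_id.
have le_swap (A : {set {set 'I_N}}) : (window_dim A <= window_dim (f @: A))%N.
  have [rho Crho] := C_sym (tperm x y).
  pose T := linfun (mxsub (tperm x y) rho : word -> word).
  have T_inj : lker T == 0%VS.
    apply/lker0P => X Y; rewrite !lfunE /= => /matrixP XY.
    apply/matrixP => n c; have := XY (tperm x y n) (rho^-1%g c).
    by rewrite !mxE tpermK permKV.
  rewrite /window_dim -(limg_dim_eq (f := T)) ?(eqP T_inj) ?capv0 //.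
  rewrite dimvS // limgD addvS //.
    apply/subvP => _ /memv_imgP[X /zerosP X0 ->]; apply/zerosP => n c Wn.
    rewrite lfunE /= mxE X0 //; case: tpermP => [nx|ny|//].
      by rewrite -Wxy -nx.
    by rewrite Wxy -ny.
  rewrite limg_sum; apply/subv_sumP => V AV.
  apply: subv_trans (sumv_sup (f V) _ (subvv _)); last exact: imset_f.
  apply/subvP => _ /memv_imgP[X /supportedP[CX X0] ->]; apply/supportedP.
  rewrite lfunE /=; split; first exact: Crho.
  by move=> n c; rewrite fE mem_tperm_imset mxE; apply: X0.
apply/eqP; rewrite eqn_leq le_swap andbT.
apply: leq_trans (le_swap (f @: J)) _; rewrite -imset_comp.
by rewrite (eq_imset _ (_ : f \o f =1 id)) ?imset_id.
Qed.

Variables (S : nat).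
Hypothesis s_lt_S : (s < S)%N.
Definition meeting : {set {set 'I_N}} :=
  [set V : {set 'I_N} | (#|V| == S) && ~~ [disjoint V & W]].

Lemma swap_within_meeting f : swap_within f -> f @: meeting \subset meeting.
Proof.
move=> [x [y [Wxy ->]]]; apply/subsetP => _ /imsetP[V + ->]; rewrite !inE.
rewrite card_imset; last exact: perm_inj.
case/andP=> -> /pred0Pn[n /andP[/= Vn Wn]]; apply/pred0Pn; exists (tperm x y n).
rewrite /= mem_tperm_imset tpermK Vn /=; case: tpermP => [nx|ny|//].
  by rewrite -Wxy -nx.
by rewrite Wxy -ny.
Qed.

(* The supported words of two sets that share at least s points span the
   words supported on their union, so an invariant family generates the words
   supported on every larger set that its members reach by swaps. *)
Lemma swap_closed_span (J : {set {set 'I_N}}) (V U : {set 'I_N}) :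
    J \subset meeting -> (forall f, swap_within f -> f @: J \subset J) ->
    V \in J -> V \subset U -> (V \subset W -> U \subset W) ->
  (supported U <= \sum_(V in J) supported V)%VS.
Proof.
move=> sJ Jinv JV sVU VW; have := subsetP sJ V JV; rewrite inE.
case/andP=> /eqP cV /pred0Pn[v /andP[/= Vv Wv]].
move: {2}#|_|.+1 (ltnSn #|U :\: V|) => k.
elim: k U sVU VW => // k IH U sVU VW; rewrite ltnS => cU.
have [UV0|[n]] := set_0Vmem (U :\: V).
  rewrite (sumv_sup V) // supportedS //.
  by rewrite -setD_eq0 UV0.
rewrite inE => /andP[V'n Un].
have [c Vc Wcn] : exists2 c, c \in V & (c \in W) = (n \in W).
  have [Wn|W'n] := boolP (n \in W); first by exists v.
  have : ~~ (V \subset W).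
    by apply/negP => /VW /subsetP/(_ n Un); rewrite (negbTE W'n).
  by case/subsetPn => c Vc /negbTE Wc; exists c.
(* [V'] trades [c] for [n], on the same side of [W], and stays inside [U]; its words allow [n] to be
   removed from [U]. *)
pose V' := tperm c n @: V.
have JV' : V' \in J.
  apply: (subsetP (Jinv (fun V : {set 'I_N} => tperm c n @: V) _)); first by exists c, n.
  exact: (imset_f (fun V : {set 'I_N} => tperm c n @: V)).
apply: subv_trans (@supported_add_point U V' n _ _ _) _.
- by rewrite mem_tperm_imset tpermR.
- apply/subsetP => m; rewrite mem_tperm_imset; case: tpermP => [->|->|_ _] //.
  + by move=> _; apply: (subsetP sVU).
  + exact: (subsetP sVU).
- by rewrite card_imset ?cV //; apply: perm_inj.
rewrite subv_add; apply/andP; split; last by rewrite (sumv_sup V').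
apply: IH.
- by rewrite subsetD1 sVU.
- by move=> /VW; apply: subset_trans; apply: subD1set.
- apply: leq_trans cU; rewrite (cardsD1 n (U :\: V)) inE V'n Un ltnS.
  by rewrite subset_leq_card //; apply/subsetP => m; rewrite !inE => /and3P[-> -> ->].
Qed.

(** By uncrossing, [J] may be taken invariant. If a member leaves [W], the words of [J] fill the
    window. Otherwise they generate [supported W], of dimension at least [a * (#|W| - S + 1)], while
    [J] has at most ['C(#|W|, S)] members. *)
Lemma window_dim_ge (r : nat) :
    (s <= #|~: W|)%N -> (r * #|meeting| <= a * #|W|)%N ->
    (r * 'C(#|W|, S) <= a * (#|W| - S + 1))%N ->
  forall J : {set {set 'I_N}}, J \subset meeting ->
    (\dim (zeros K a W) + r * #|J| <= window_dim J)%N.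
Proof.
move=> sW rA rC; apply: (uncrossing (G := swap_within)).
- exact: window_dim_submod.
- exact: swap_within_inj.
- exact: swap_within_meeting.
- by move=> f J; apply: window_dim_swap.
move=> J sJ Jinv; have [->|[V JV]] := set_0Vmem J.
  by rewrite cards0 muln0 addn0 dimvS // addvSl.
have cJ : (#|J| <= #|meeting|)%N by apply: subset_leq_card.
have [VW|V'W] := boolP (all (fun V : {set 'I_N} => V \subset W) (enum J)); last first.
  case/allPn: V'W => V1; rewrite mem_enum => JV1 V'W.
  rewrite /window_dim (_ : (_ + _)%VS = fullv).
    rewrite -(dim_zeros K a W) leq_add2l [(#|W| * a)%N]mulnC (leq_trans _ rA) //.
    by rewrite leq_mul2l cJ orbT.
  apply/eqP; rewrite eqEsubv subvf -(@supported_onto setT W) ?subsetT ?setTD //.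
  rewrite addvC addvS //; apply: (@swap_closed_span J V1) => //.
  by rewrite (negbTE V'W).
have {}VW V1 : V1 \in J -> V1 \subset W.
  by move=> JV1; apply: (allP VW); rewrite mem_enum.
have := subsetP sJ V JV; rewrite inE => /andP[/eqP cV _].
have cW : (S <= #|W|)%N by rewrite -cV subset_leq_card ?VW.
have S_gt0 : (0 < S)%N by apply: leq_ltn_trans s_lt_S.
apply: (@leq_trans (\dim (zeros K a W) + a * (#|W| - S + 1))).
  rewrite leq_add2l (leq_trans _ rC) // leq_mul2l -cards_draws.
  rewrite subset_leq_card ?orbT //; apply/subsetP => V1 JV1; rewrite inE VW //=.
  by have := subsetP sJ V1 JV1; rewrite inE => /andP[].
apply: (@leq_trans (\dim (zeros K a W + supported W))); last first.
  rewrite dimvS // addvS //; apply: (@swap_closed_span J V) => //; exact: VW.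
rewrite dimv_disjoint_sum; last first.
  apply/eqP; rewrite -subv0; apply/subvP => X; rewrite memv_cap memv0.
  case/andP=> /zerosP XW /supportedP[_ X'W]; apply/eqP/matrixP => n c.
  by rewrite mxE; have [/XW|/X'W] := boolP (n \in W).
rewrite leq_add2l.
(* Outside [W1] there remain [S - 1 >= s] rows of [W], so [supported W] projects onto the rows
   [W1]. *)
have [W1 sW1 cW1] : exists2 W1 : {set 'I_N}, W1 \subset W & #|W1| = (#|W| - S + 1)%N.
  have : (0 < #|[set A : {set 'I_N} | A \subset W & #|A| == (#|W| - S + 1)%N]|)%N.
    by rewrite cards_draws bin_gt0 -[leqRHS](subnK cW) leq_add2l.
  by case/card_gt0P => A; rewrite inE => /andP[sA /eqP]; exists A.
have := @supported_onto W W1 sW1; rewrite cardsD (setIidPr sW1) cW1 => onto1.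
rewrite -cW1 mulnC -(leq_add2l (\dim (zeros K a W1))) dim_zeros -onto1 1?addnC.
  by rewrite dimv_add_leqif.
by rewrite addnC subnDA subKn // subn1 -ltnS prednK.
Qed.

End Window.

End MDSCode.

(** * Stacked Reed-Solomon codes *)

Section ReedSolomon.
Variables (K : fieldType) (N a m : nat) (beta : 'I_a -> 'I_N -> K).

Definition evaluation (P : 'M[K]_(m, a)) : 'M[K]_(N, a) :=
  \matrix_(n, c) \sum_(i < m) P i c * beta c n ^+ i.

Fact evaluation_linear : linear evaluation.
Proof.
move=> k P Q; apply/matrixP => n c; rewrite !mxE mulr_sumr -big_split /=.
by apply: eq_bigr => i _; rewrite !mxE mulrDl mulrA.
Qed.
HB.instance Definition _ :=
  GRing.isLinear.Build K _ _ _ evaluation evaluation_linear.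

Definition rs_code : {vspace 'M[K]_(N, a)} := limg (linfun evaluation).

Lemma rs_codeP (X : 'M[K]_(N, a)) : reflect (exists p : 'I_a -> {poly K},
    forall c, (size (p c) <= m)%N /\ forall n, X n c = (p c).[beta c n])
  (X \in rs_code).
Proof.
apply: (iffP memv_imgP) => [[P _ ->]|[p pX]].
  exists (fun c => \poly_(i < m) \sum_(j < m | j == i :> nat) P j c) => c.
  split=> [|n]; first exact: size_poly.
  rewrite lfunE mxE horner_poly; apply: eq_bigr => i _; congr (_ * _).
  by rewrite (big_pred1 i).
exists (\matrix_(i, c) (p c)`_i); rewrite ?memvf //.
apply/matrixP => n c; rewrite lfunE mxE; have [sp ->] := pX c.
by rewrite (horner_coef_wide _ sp); apply: eq_bigr => i _; rewrite mxE.
Qed.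

(** The polynomial with roots at the points outside [U] has degree [N - #|U| < m] and gives the
    short words. Conversely, a polynomial of size at most [m] with at least [m] roots is zero. *)
Lemma rs_code_mds : (m <= N)%N -> (forall c, injective (beta c)) ->
  mds_code (N - m) rs_code.
Proof.
move=> mN inj_beta; split=> [U n c Un cU|U X cU].
  pose p : {poly K} := \prod_(n' <- enum (~: U)) ('X - (beta c n')%:P).
  have rootp n' : root p (beta c n') = (n' \notin U).
    rewrite /p -(big_map (beta c) xpredT (fun z => 'X - z%:P)) root_prod_XsubC.
    by rewrite mem_map // mem_enum inE.
  have pn : p.[beta c n] != 0 by rewrite -rootE rootp negbK.
  exists (\matrix_(n', c') if c' == c then p.[beta c n'] / p.[beta c n] else 0).
    apply/rs_codeP; exists (fun c' => if c' == c then (p.[beta c n])^-1 *: p else 0).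
    move=> c'; split=> [|n']; last first.
      by rewrite mxE; case: eqP => [->|_]; rewrite ?horner0 // hornerZ mulrC.
    case: eqP => _; last by rewrite size_poly0.
    rewrite (leq_trans (size_scale_leq _ _)) // size_prod_XsubC -cardE.
    have := cardsC U; rewrite card_ord; move: cU mN; clear; lia.
  split=> [|n' c']; rewrite mxE ?eqxx ?divff //.
  case: (c' =P c) => //= _; rewrite orbF -rootp => /rootP->; exact: mul0r.
move=> /rs_codeP[p pX] /zerosP X0; apply/matrixP => n c; rewrite mxE.
have [sp ->] := pX c; suff -> : p c = 0 by rewrite horner0.
apply: (@roots_geq_poly_eq0 _ _ [seq beta c n' | n' <- enum (~: U)]).
- apply/allP => _ /mapP[n' n'U ->]; rewrite mem_enum in n'U.
  by rewrite rootE -(pX c).2 X0.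
- by rewrite map_inj_uniq // enum_uniq.
rewrite size_map -cardE cardsCs setCK card_ord (leq_trans sp) //.
by rewrite -[leqLHS](subKn mN) leq_sub2l.
Qed.

End ReedSolomon.

(* The columns are indexed by pairs (permutation of the servers, label), and
   the permutation is applied to the evaluation points: permuting the servers
   then amounts to permuting the columns. *)
Lemma symmetric_mds_code (K : fieldType) (N m t : nat) (alpha : 'I_N -> K) :
    injective alpha -> (m <= N)%N ->
  exists C : {vspace 'M[K]_(N, N`! * t)},
    mds_code (N - m) C /\ symmetric_code C.
Proof.
move=> inj_alpha mN.
have card_a : #|{: 'S_N * 'I_t}| = (N`! * t)%N by rewrite card_prod card_Sn card_ord.
rewrite -card_a; pose col (c : 'I_#|{: 'S_N * 'I_t}|) := enum_val c.
pose beta c n := alpha ((col c).1 n).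
exists (rs_code m beta); split.
  by apply: rs_code_mds => // c n n' /inj_alpha; apply: perm_inj.
(* Column [rho c] has at server [sigma n] the evaluation point that column [c] has at [n]. *)
move=> sigma; pose rho c := enum_rank ((sigma^-1 * (col c).1)%g, (col c).2).
have rho_inj : injective rho.
  move=> c c' /enum_rank_inj[/mulgI e1 e2]; apply: enum_val_inj.
  by rewrite -/(col c) -/(col c') [col c]surjective_pairing e1 e2 -surjective_pairing.
exists (perm rho_inj) => X /rs_codeP[p pX]; apply/rs_codeP.
exists (fun c => p (rho c)) => c; split=> [|n]; first exact: (pX _).1.
rewrite mxE permE (pX _).2; congr (_.[alpha _]).
by rewrite /col enum_rankK /= permM permK.
Qed.

(** * The linear scheme *)

Section Binomials.
Local Open Scope nat_scope.

(** Sets of [M] and [w + 1] points that share one point have no common [S]-subset, and their union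
    has [M + w] points. *)
Lemma leq_binD M w S : 0 < M -> 1 < S ->
  'C(M, S) + 'C(w.+1, S) <= 'C(M + w, S).
Proof.
case: S => [|[|S]] // M_gt0 _; elim: M M_gt0 => // -[_ _|M IH _].
  by rewrite bin_small // add1n.
rewrite addSn [in X in X + _]binS [in leqRHS]binS addnAC leq_add ?IH //.
by rewrite leq_bin2l // leq_addr.
Qed.

(** For [w = N - M] this is the requirement on families inside a window. It follows from [(w + 1) *
    'C(w, S) = (w + 1 - S) * 'C(w + 1, S)] and [leq_binD]. *)
Lemma bin_window M w S : 0 < M -> 1 < S ->
  w * 'C(w, S) <= ('C(M + w, S) - 'C(M, S)) * (w - S + 1).
Proof.
move=> M_gt0 S_gt1; have [wS|Sw] := ltnP w S; first by rewrite bin_small ?muln0.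
have := leq_binD w M_gt0 S_gt1; rewrite -leq_subRL ?leq_bin2l ?leq_addr //.
move=> le_A; apply: leq_trans (leq_mul (leqnSn w) (leqnn _)) _.
by rewrite (mul_bin_down w.+1 S) mulnC addn1 -subSn // leq_mul2r le_A orbT.
Qed.

Lemma rate_pos N M Nr S : M < N -> N - M < Nr -> Nr <= N -> N - Nr + 2 <= S ->
    S <= N ->
  (N - M) * 'C(N, S) < ('C(N, S) - 'C(M, S)) * Nr.
Proof.
move=> MN NrM NrN sS SN.
have B_gt0 : 0 < 'C(N, S) by rewrite bin_gt0.
have [MS|SM] := ltnP M S.
  by rewrite [in 'C(M, S)]bin_small // subn0 mulnC ltn_pmul2l.
have [S' SE] : exists S', S = S'.+1 by exists S.-1; rewrite prednK //; lia.
have le_ratio : 'C(M, S) * (N - S + 1) <= 'C(N, S) * (M - S + 1).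
  have e1 : S'.+1 * 'C(M, S'.+1) = (M - S + 1) * 'C(M, S').
    by rewrite mul_bin_left; congr (_ * _); lia.
  have e2 : S'.+1 * 'C(N, S'.+1) = (N - S + 1) * 'C(N, S').
    by rewrite mul_bin_left; congr (_ * _); lia.
  rewrite -(leq_pmul2l (ltn0Sn S')) !mulnA [in 'C(M, S)]SE [in 'C(N, S)]SE e1 e2.
  rewrite mulnAC [leqRHS]mulnAC [X in _ <= X * _]mulnC leq_mul2l.
  by rewrite leq_bin2l ?orbT // ltnW.
have lt_C : 'C(M, S) < 'C(N, S).
  rewrite ltnNge; apply/negP => le_C.
  have := leq_trans (leq_mul le_C (leqnn (N - S + 1))) le_ratio.
  by rewrite leq_pmul2l //; lia.
rewrite [ltnRHS]mulnBl ltn_subRL.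
(* [le_ratio] accounts for the first two summands; the last one is positive and gives strictness. *)
have NrE : Nr = (M - S + 1) + (N - M) + (S - 1 - (N - Nr)) by lia.
have d_gt0 : 0 < S - 1 - (N - Nr) by lia.
have NSE : N - S + 1 = (M - S + 1) + (N - M) by lia.
have lt_d : 'C(M, S) * (S - 1 - (N - Nr)) < 'C(N, S) * (S - 1 - (N - Nr)).
  by rewrite ltn_pmul2r.
rewrite NrE [(N - M) * _]mulnC; move: le_ratio; rewrite NSE !mulnDr.
by move: lt_d; clear; lia.
Qed.

End Binomials.

Section Vectors.
Variables (K : fieldType) (vT : vectType K) (n : nat).

Definition combination (y : 'I_n -> vT) (v : 'rV[K]_n) : vT := \sum_i v 0 i *: y i.

Fact combination_linear y : linear (combination y).
Proof.
move=> k u v; rewrite /combination scaler_sumr -big_split; apply: eq_bigr => i _.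
by rewrite !mxE scalerDl scalerA.
Qed.
HB.instance Definition _ y :=
  GRing.isLinear.Build K _ _ _ (combination y) (combination_linear y).

Lemma exists_embedding (U : {vspace vT}) : (n <= \dim U)%N ->
  exists2 b : 'Hom('rV[K]_n, vT), forall v, b v \in U & lker b = 0%VS.
Proof.
move=> nU; pose X := take n (vbasis U).
have szX : size X == n by rewrite size_takel // size_tuple.
exists (linfun (combination (fun i => X`_i))) => [v|].
  rewrite lfunE; apply: memv_suml => i _; apply: memvZ; apply: (vbasis_mem (U := U)).
  by rewrite (mem_take (n0 := n)) // mem_nth // (eqP szX).
apply/eqP; rewrite -subv0; apply/subvP => v; rewrite memv_ker memv0 lfunE => /eqP v0.
have freeX : free (Tuple szX).
  apply: (@catl_free _ _ (drop n (vbasis U))); rewrite cat_take_drop.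
  exact: basis_free (vbasisP U).
move/freeP: freeX => /(_ (fun i => v 0 i) v0) v0'; apply/eqP/rowP => i.
by rewrite mxE v0'.
Qed.

End Vectors.

Lemma card_meeting N S (W : {set 'I_N}) :
  #|meeting W S| = ('C(N, S) - 'C(N - #|W|, S))%N.
Proof.
have cC : #|~: W| = (N - #|W|)%N by rewrite cardsCs setCK card_ord.
have all : #|[set V : {set 'I_N} | V \subset setT & #|V| == S]| = 'C(N, S).
  by rewrite cards_draws cardsT card_ord.
rewrite -cC -cards_draws -all; apply/eqP.
rewrite -(eqn_add2r #|[set V : {set 'I_N} | V \subset ~: W & #|V| == S]|) subnK; last first.
  by apply: subset_leq_card; apply/subsetP => V; rewrite !inE subsetT => /andP[].
apply/eqP; rewrite -[RHS](cardsID (meeting W S)); congr (_ + _)%N; apply: eq_card => V.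
  by rewrite !inE subsetT andbA andbb.
by rewrite !inE subsetT /= disjoints_subset; case: (#|V| == S); rewrite ?andbF //= negbK andbT.
Qed.

Lemma card_key_group N S : #|key_group N S| = 'C(N, S).
Proof.
rewrite card_sig -[N in RHS]card_ord -cardsT -cards_draws; apply: eq_card => V.
by rewrite !inE subsetT.
Qed.

(** * Key words and encoding maps *)

Section KeySpace.
Variables (K : fieldType) (N M Nr S a r : nat).
Hypotheses (M_lt_N : (M < N)%N) (Nr_le_N : (Nr <= N)%N).
Hypotheses (Nr_gt : (N - M < Nr)%N) (S_ge : (N - Nr + 2 <= S)%N).
Hypotheses (ra : (r * ('C(N, S) - 'C(M, S)) = a * (N - M))%N).
Hypothesis (ra_inside : (r * 'C(N - M, S) <= a * (N - M - S + 1))%N).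
Variable C : {vspace 'M[K]_(N, a)}.
Hypotheses (C_mds : mds_code (N - Nr) C) (C_sym : symmetric_code C).
Local Notation I := (key_group N S * 'I_r)%type.
Variable scalars : seq K.
Hypothesis uniq_scalars : uniq scalars.
Hypothesis many_scalars : (#|{: {set 'I_N} * {set I}}| < size scalars)%N.

(** Rado's theorem makes the key words that meet a window independent there. Their number is the
    codimension of [zeros K a W], so they span the window. *)
Lemma exists_keys : exists y : I -> 'M[K]_(N, a),
  (forall i, y i \in supported C (val i.1)) /\
  forall W : {set 'I_N}, #|W| = (N - M)%N ->
    (zeros K a W + \sum_i <[y i]>)%VS = fullv.
Proof.
pose A (W : {set 'I_N}) : {set I} :=
  if #|W| == (N - M)%N then [set i : I | ~~ [disjoint val i.1 & W]] else set0.
pose Y (i : I) := supported C (val i.1).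
have cardA (W : {set 'I_N}) : #|W| = (N - M)%N -> #|A W| = (a * (N - M))%N.
  move=> cW; rewrite /A cW eqxx -ra -[in 'C(M, S)](subKn (ltnW M_lt_N)) -cW -card_meeting.
  pose Bk := [set V : key_group N S | ~~ [disjoint val V & W]].
  have -> : [set i : I | ~~ [disjoint val i.1 & W]] = setX Bk setT.
    by apply/setP => i; rewrite !inE andbT.
  rewrite cardsX cardsT card_ord mulnC; congr (_ * _)%N.
  rewrite -(card_imset _ val_inj); apply: eq_card => V; rewrite inE.
  apply/imsetP/andP => [[V']|[cV VW]].
    by rewrite inE => V'W ->; split=> //; apply: (valP V').
  by exists (Sub V cV); rewrite ?inE.
have condY : rado_condition (zeros K a) A Y.
  move=> W J; rewrite /A; case: eqP => [cW sJ|_]; last first.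
    by rewrite subset0 => /eqP->; rewrite cards0 addn0 dimvS // addvSl.
  pose VJ := [set val i.1 | i in J].
  have sVJ : VJ \subset meeting W S.
    apply/subsetP => _ /imsetP[i Ji ->]; rewrite inE (valP i.1) /=.
    by have := subsetP sJ i Ji; rewrite inE.
  (* Each support carries at most [r] key words, so a bound for sets of supports is enough. *)
  have cJ : (#|J| <= r * #|VJ|)%N.
    rewrite mulnC -[X in (_ <= _ * X)%N]card_ord -cardsT -cardsX.
    have inj_v : injective (fun i : I => (val i.1, i.2)).
      by move=> [V i] [V' i'] /= [/val_inj-> ->].
    rewrite -(card_imset _ inj_v); apply/subset_leq_card/subsetP.
    move=> _ /imsetP[i Ji ->]; rewrite in_setX in_setT andbT.
    exact: (imset_f (fun i : I => val i.1) Ji).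
  have S_gt : (N - Nr < S)%N by rewrite (leq_trans _ S_ge) // addn2 ltnS leqnSn.
  have := @window_dim_ge K N a (N - Nr) C C_mds C_sym W S S_gt r.
  rewrite card_meeting cW (subKn (ltnW M_lt_N)) ra leqnn cardsCs setCK card_ord cW.
  rewrite (subKn (ltnW M_lt_N)) => /(_ _ isT ra_inside VJ sVJ) VJ_dim.
  apply: (@leq_trans (\dim (zeros K a W) + r * #|VJ|)); first by rewrite leq_add2l.
  apply: leq_trans (VJ_dim _) _; first by move: Nr_gt M_lt_N Nr_le_N; clear; lia.
  rewrite dimvS // addvS //; apply/subv_sumP => _ /imsetP[i Ji ->].
  by rewrite (sumv_sup i).
have [y [Yy condy]] := rado uniq_scalars many_scalars condY.
exists y; split=> // W cW; apply/eqP; rewrite eqEdim subvf /=.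
have := condy W (A W) (subxx _); rewrite cardA // -cW mulnC dim_zeros => dimA.
apply: leq_trans dimA _; rewrite dimvS // addvS //; apply/subv_sumP => i _.
by rewrite (sumv_sup i).
Qed.

Variable l : nat.
Hypothesis l_le : (l <= Nr * a - r * 'C(N, S))%N.

(** Data are embedded by [b] into a complement of [Ks] in [C], and [E T] projects [b v] along [Ks]
    onto the words that vanish outside [T]. Hence all [E T v] agree modulo [Ks]. A word of [C] with
    [Nr] zero rows is zero, which forces [b v] into [Ks] and so [v = 0]. *)
Lemma exists_linear_scheme :
  exists (E : {set 'I_N} -> 'Hom('rV[K]_l, 'M[K]_(N, a)))
         (kappa : key_group N S -> 'Hom('rV[K]_r, 'M[K]_(N, a))),
  [/\ forall (T : {set 'I_N}) v n c, n \notin T -> E T v n c = 0,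
      forall (V : key_group N S) q n c, n \notin val V -> kappa V q n c = 0,
      forall (T T' : {set 'I_N}) v, #|T| = M -> #|T'| = M ->
        exists q, E T v = E T' v + \sum_V kappa V (q V) &
      forall (T U : {set 'I_N}) v q, #|T| = M -> #|U| = Nr ->
        E T v + \sum_V kappa V (q V) \in zeros K a U -> v = 0].
Proof.
have [y [Yy y_full]] := exists_keys.
pose Ks := (\sum_i <[y i]>)%VS.
have KsC : (Ks <= C)%VS.
  by apply/subv_sumP => i _; rewrite -memvE; case/supportedP: (Yy i).
have dimKs : (\dim Ks <= r * 'C(N, S))%N.
  apply: leq_trans (dimv_leq_sum _ _ _) _.
  apply: (@leq_trans (\sum_(i : I) 1)).
    by apply: leq_sum => i _; rewrite dim_vline leq_b1.
  by rewrite sum1_card card_prod card_ord card_key_group mulnC.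
have dimC : (Nr * a <= \dim C)%N.
  by apply: (@dim_code_ge K N a (N - Nr) C C_mds Nr); rewrite subnKC.
have [b bC' b_inj] : exists2 b : 'Hom('rV[K]_l, 'M[K]_(N, a)),
    forall v, b v \in (C :\: Ks)%VS & lker b = 0%VS.
  apply: exists_embedding; apply: leq_trans l_le _.
  rewrite leq_subLR (leq_trans dimC) // -(dimv_cap_compl C Ks) leq_add2r.
  by rewrite (leq_trans _ dimKs) // dimvS // capvSr.
pose E (T : {set 'I_N}) := (addv_pi1 (zeros K a (~: T)) Ks \o b)%VF.
pose kappa (V : key_group N S) : 'Hom('rV[K]_r, 'M[K]_(N, a)) :=
  linfun (combination (fun i => y (V, i))).
have kappaE V q : kappa V q = \sum_i q 0 i *: y (V, i) by rewrite lfunE.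
have kappa_Ks q : \sum_V kappa V (q V) \in Ks.
  apply: memv_suml => V _; rewrite kappaE; apply: memv_suml => i _; apply: memvZ.
  by rewrite memvE (sumv_sup (V, i)).
have E_Ks (T : {set 'I_N}) v : #|T| = M -> b v - E T v \in Ks.
  move=> cT; rewrite /E lfunE /= -{1}[b v](addv_pi1_pi2 (U := zeros K a (~: T)) (V := Ks)).
    by rewrite addrAC subrr add0r memv_pi2.
  by rewrite y_full ?memvf // cardsCs setCK card_ord cT.
have Ks_kappa X : X \in Ks -> exists q, X = \sum_V kappa V (q V).
  case/memv_sumP => x xy ->.
  have /fin_all_exists[k Hk] (i : I) : exists k, x i = k *: y i.
    by have /vlineP[k ->] := xy i isT; exists k.
  exists (fun V => \row_i k (V, i)).
  under [RHS]eq_bigr => V _ do rewrite kappaE.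
  rewrite pair_bigA /=; apply: eq_bigr => -[V i] _ /=.
  by rewrite mxE Hk.
exists E, kappa; split=> [T v n c Tn|V q n c Vn|T T' v cT cT'|T U v q cT cU].
- have /zerosP-> // : E T v \in zeros K a (~: T) by rewrite /E lfunE memv_pi1.
  by rewrite inE.
- rewrite kappaE summxE big1 // => i _; rewrite mxE.
  by have /supportedP[_ ->] := Yy (V, i); rewrite ?mulr0.
- have [q Hq] : exists q, E T v - E T' v = \sum_V kappa V (q V).
    apply: Ks_kappa; have -> : E T v - E T' v = (b v - E T' v) - (b v - E T v).
      by rewrite opprB [RHS]addrC subrKA.
    by rewrite memvB // E_Ks.
  by exists q; rewrite -Hq addrC subrK.
set X := _ + _ => XU.
have bC : b v \in C by apply: subvP (diffvSl _ _) _ (bC' v).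
have XC : X \in C.
  rewrite memvD //; last exact: subvP KsC _ (kappa_Ks q).
  by rewrite -[E T v](subKr (b v)) memvB // (subvP KsC _ (E_Ks T v cT)).
have X0 : X = 0.
  apply: (C_mds.2 (~: U)); rewrite ?setCK //.
  by rewrite cardsCs setCK card_ord cU.
have bKs : b v \in Ks.
  have := E_Ks T v cT; rewrite (_ : E T v = - \sum_V kappa V (q V)); last first.
    by apply/eqP; rewrite -addr_eq0 -/X X0.
  by rewrite opprK rpredDr.
have : b v \in ((C :\: Ks) :&: Ks)%VS by rewrite memv_cap bC'.
rewrite capv_diff memv0 => /eqP b0; apply/eqP.
by rewrite -memv0 -b_inj memv_ker b0.
Qed.

End KeySpace.

(** In the splitting field of ['X^e - 'X], with [e] a power of [#|F|], the roots are distinct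
    because the derivative is [-1]. *)
Lemma big_extension (F : finFieldType) n :
  exists (L : fieldExtType F) (s : seq L), uniq s /\ (n < size s)%N.
Proof.
have q_gt1 : (1 < #|F|)%N by apply: finNzRing_gt1.
pose e := (#|F| ^ n.+1)%N.
have e_gt : (n.+1 < e)%N by apply: ltn_expl.
pose p : {poly F} := 'X^e - 'X.
have sz_p : size p = e.+1.
  by rewrite size_polyDl ?size_polyXn // size_polyN size_polyX ltnS (leq_trans _ e_gt).
have p_neq0 : p != 0 by rewrite -size_poly_eq0 sz_p.
have e0 : e%:R = 0 :> F.
  rewrite natrX exprS (_ : #|F|%:R = 0) ?mul0r //.
  by have := expg_cardG (in_setT (1 : F)); rewrite FinRing.zmodXgE cardsT.
have sep_p : separable_poly p.
  rewrite unlock derivB derivXn derivX -mulr_natr -polyC_natr e0 mulr0 sub0r.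
  by rewrite -[- 1]scaleN1r coprimepZr ?coprimep1 // oppr_eq0 oner_eq0.
have [L [rs p_rs _]] := FinSplittingFieldFor p_neq0.
exists L, rs; split.
  rewrite -separable_prod_XsubC -(eqp_separable p_rs).
  by rewrite separable_map.
have := eqp_size p_rs; rewrite size_map_poly sz_p size_prod_XsubC => -[<-].
exact: ltnW.
Qed.

Lemma rows_over_extension (F : fieldType) (L : fieldExtType F) n :
  exists (f : 'rV[F]_(n * dim L) -> 'rV[L]_n) (g : 'rV[L]_n -> 'rV[F]_(n * dim L)),
    [/\ forall x y, f (x + y) = f x + f y, cancel f g & cancel g f].
Proof.
exists (fun x => \row_i r2v (row i (vec_mx x))).
exists (fun u => mxvec (\matrix_i v2r (u 0 i))); split=> [x y|x|u].
- by apply/rowP => i; rewrite !mxE linearD /= linearD /= linearD.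
- rewrite -[RHS]vec_mxK; congr mxvec; apply/row_matrixP => i.
  by rewrite rowK mxE r2vK.
- by apply/rowP => i; rewrite mxE mxvecK rowK v2rK.
Qed.

(** * The scheme over the base field *)

Section Assembly.
Variables (R : realType) (F : finFieldType) (K N Nr M S : nat).
Variable D : 'I_K -> {set 'I_N}.
Hypotheses (K_gt0 : (0 < K)%N) (D_ge : forall k, (M <= #|D k|)%N).
Variables (L : fieldExtType F) (a r l : nat).
Variables (E : {set 'I_N} -> 'Hom('rV[L]_l, 'M[L]_(N, a)))
          (kappa : key_group N S -> 'Hom('rV[L]_r, 'M[L]_(N, a))).
Hypothesis E_supp :
  forall (T : {set 'I_N}) v n c, n \notin T -> E T v n c = 0.
Hypothesis kappa_supp :
  forall (V : key_group N S) q n c, n \notin val V -> kappa V q n c = 0.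
Hypothesis E_keys : forall (T T' : {set 'I_N}) v, #|T| = M -> #|T'| = M ->
  exists q, E T v = E T' v + \sum_V kappa V (q V).
Hypothesis E_dec : forall (T U : {set 'I_N}) v q, #|T| = M -> #|U| = Nr ->
  E T v + \sum_V kappa V (q V) \in zeros L a U -> v = 0.

(** Modulo key words, each gradient can be moved to the common set [T0], where the encoding is
    linear. *)
Lemma sum_encodings (T : 'I_K -> {set 'I_N}) (T0 : {set 'I_N}) (v : 'I_K -> 'rV[L]_l) :
    (forall k, #|T k| = M) -> #|T0| = M ->
  exists q, \sum_k E (T k) (v k) = E T0 (\sum_k v k) + \sum_V kappa V (q V).
Proof.
move=> cT cT0; have /fin_all_exists[q Hq] k := E_keys (v k) (cT k) cT0.
exists (fun V => \sum_k q k V); rewrite linear_sum /=.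
under [X in _ + X]eq_bigr => V _ do rewrite linear_sum /=.
by rewrite exchange_big -big_split; apply: eq_bigr.
Qed.

(** Each gradient is encoded on [M] of the servers that hold it. By [sum_encodings] the sent word is
    [E T0] of the sum plus key words: [E_dec] on a difference of two words gives decodability, and
    shifting the keys gives security. *)
Lemma scheme_of_linear_code :
  exists s : scheme R F Nr S D (l * dim L), forall n, msg_len s n = (a * dim L)%N.
Proof.
have /fin_all_exists[T HT] (k : 'I_K) :
    exists T : {set 'I_N}, T \subset D k /\ #|T| = M.
  have : (0 < #|[set A : {set 'I_N} | A \subset D k & #|A| == M]|)%N.
    by rewrite cards_draws bin_gt0 D_ge.
  by case/card_gt0P => A; rewrite inE => /andP[sA /eqP]; exists A.
have cT k : #|T k| = M by case: (HT k).
pose T0 := T (Ordinal K_gt0); have cT0 : #|T0| = M by exact: cT.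
have [fl [gl [flD flK glK]]] := rows_over_extension L l.
have [fr [gr [frD frK grK]]] := rows_over_extension L r.
have [fa [ga [faD faK gaK]]] := rows_over_extension L a.
have fl_sum (u : 'I_K -> 'rV[F]_(l * dim L)) : fl (\sum_k u k) = \sum_k fl (u k).
  have fl0 : fl 0 = 0 by apply: (addrI (fl 0)); rewrite -flD !addr0.
  by apply: (big_morph fl flD fl0).
pose word (w : {ffun key_group N S -> 'rV[F]_(r * dim L)} *
               {ffun 'I_K -> 'rV[F]_(l * dim L)}) :=
  \sum_k E (T k) (fl (w.2 k)) + \sum_V kappa V (fr (w.1 V)).
apply: (@scheme_of_messages _ _ _ _ _ _ _ _ _ _ (fun w n => ga (row n (word w)))) => //.
- move=> n w w' eq_g eq_k; congr (ga _); apply/rowP => c.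
  rewrite !mxE !summxE; congr (_ + _).
    apply: eq_bigr => k _; have [nT|nT] := boolP (n \in T k); last by rewrite !E_supp.
    by rewrite eq_g // (subsetP (HT k).1).
  apply: eq_bigr => V _; have [nV|nV] := boolP (n \in val V); last by rewrite !kappa_supp.
  by rewrite eq_k.
- move=> U w w' cU eqU; apply: (can_inj flK); apply/eqP; rewrite -subr_eq0; apply/eqP.
  have [q Hq] := sum_encodings (fun k => fl (w.2 k)) cT cT0.
  have [q' Hq'] := sum_encodings (fun k => fl (w'.2 k)) cT cT0.
  rewrite !fl_sum.
  apply: (@E_dec T0 U _ (fun V => q V - q' V + (fr (w.1 V) - fr (w'.1 V))) cT0 cU).
  set Z := (Z in Z \in _); suff -> : Z = word w - word w'.
    apply/zerosP => n c nU; have /(can_inj gaK)/rowP/(_ c) := eqU n nU.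
    by rewrite !mxE => ->; rewrite subrr.
  rewrite /Z /word Hq Hq' linearB /=.
  under [X in _ + X]eq_bigr => V _ do rewrite linearD !linearB /=.
  rewrite big_split /= !sumrB [X in _ + X]addrACA -opprD addrACA -opprD.
  by rewrite !addrA.
move=> g g' sum_g.
have [q Hq] := sum_encodings (fun k => fl (g k)) cT cT0.
have [q' Hq'] := sum_encodings (fun k => fl (g' k)) cT cT0.
exists [ffun V => gr (q V - q' V)] => p; congr (fun w n => ga (row n w)).
rewrite /word Hq Hq' -!fl_sum sum_g -!addrA; congr (_ + _).
rewrite -!big_split; apply: eq_bigr => V _ /=.
by rewrite !ffunE frD grK -!linearD /=; congr (kappa V _); rewrite [RHS]addrCA [q' V + _]addrC subrK addrC.
Qed.

End Assembly.

Theorem theorem1 (R : realType) (F : finFieldType) (K N Nr M S : nat)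
    (K_gt0 : (0 < K)%N) (N_gt0 : (0 < N)%N) (Nr_gt0 : (0 < Nr)%N)
    (M_gt0 : (0 < M)%N) (S_gt0 : (0 < S)%N)
    (Nr_le_N : (Nr <= N)%N) (M_lt_N : (M < N)%N) (Nr_gt : (N - M < Nr)%N)
    (S_ge : (N - Nr + 2 <= S)%N) (S_le_N : (S <= N)%N)
    (D : 'I_K -> {set 'I_N}) (D_ge : forall k, (M <= #|D k|)%N) :
  achievable F Nr S D
    (('C(N, S)%:R - 'C(M, S)%:R) /
     (('C(N, S)%:R - 'C(M, S)%:R) * Nr%:R
      - 'C(N, S)%:R * (N%:R - M%:R)) : R).
Proof.
(* [A] and [ell] are the numerator and denominator of the rate; the factor [N!] counts the server
   permutations stacked in the code. *)
pose A := ('C(N, S) - 'C(M, S))%N; pose a := (N`! * A)%N; pose r := (N`! * (N - M))%N.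
pose ell := (A * Nr - (N - M) * 'C(N, S))%N; pose l := (N`! * ell)%N.
have ell_gt0 : (0 < ell)%N by rewrite subn_gt0 rate_pos.
(* Enough scalars for Rado's theorem and for [N] distinct evaluation points. *)
have [L [s [uniq_s]]] :=
  big_extension F (#|{: {set 'I_N} * {set key_group N S * 'I_r}}| + N).
move=> many_s.
have [C [C_mds C_sym]] : exists C : {vspace 'M[L]_(N, N`! * A)},
    mds_code (N - Nr) C /\ symmetric_code C.
  apply: (@symmetric_mds_code L N Nr A (fun n => s`_n)) => // n n' /eqP.
  by rewrite nth_uniq //; first (by move/eqP/val_inj);
    apply: leq_trans (ltnW many_s); rewrite ltn_addl.
have ra : (r * ('C(N, S) - 'C(M, S)) = a * (N - M))%N.
  by rewrite /r /a -mulnA [((N - M) * _)%N]mulnC mulnA.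
have ra_inside : (r * 'C(N - M, S) <= a * (N - M - S + 1))%N.
  rewrite /r /a -!mulnA leq_mul2l; apply/orP; right.
  have S_gt1 : (1 < S)%N by rewrite (leq_trans _ S_ge) // leq_addl.
  by have := bin_window (N - M) M_gt0 S_gt1; rewrite subnKC // ltnW.
have l_le : (l <= Nr * a - r * 'C(N, S))%N.
  by rewrite /l /a /r mulnCA -!mulnA -mulnBr [(Nr * A)%N]mulnC.
have many : (#|{: {set 'I_N} * {set key_group N S * 'I_r}}| < size s)%N.
  by apply: leq_ltn_trans many_s; apply: leq_addr.
have [E [kappa [E_supp kappa_supp E_keys E_dec]]] :=
  exists_linear_scheme M_lt_N Nr_le_N Nr_gt S_ge ra ra_inside C_mds C_sym
    uniq_s many l_le.
have [sch msg_sch] := scheme_of_linear_code R K_gt0 D_ge E_supp kappa_supp E_keys E_dec.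
have dimL_gt0 : (0 < dim L)%N.
  rewrite -(dimvf L) lt0n dimv_eq0.
  by apply/negP => /eqP L0; have := memvf (1 : L); rewrite L0 memv0 oner_eq0.
have l_gt0 : (0 < l)%N by rewrite muln_gt0 fact_gt0.
exists (l * dim L)%N; split; first by rewrite muln_gt0 l_gt0.
exists sch; rewrite /comm_cost; under eq_bigr do rewrite msg_sch.
rewrite (_ : (\max_(n < N) _)%N = (a * dim L)%N); last first.
  apply/eqP; rewrite eqn_leq; apply/andP; split; first by apply/bigmax_leqP.
  exact: (leq_bigmax_cond (Ordinal N_gt0)).
have BC : ('C(M, S) <= 'C(N, S))%N by rewrite leq_bin2l // ltnW.
rewrite -(natrB _ BC) -/A -(natrB _ (ltnW M_lt_N)) -!natrM [('C(N, S) * _)%N]mulnC.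
rewrite -natrB; last by rewrite ltnW // rate_pos.
rewrite -/ell !natrM.
have nz n : (0 < n)%N -> n%:R != 0 :> R by rewrite pnatr_eq0 lt0n.
(* The factors [N!] and [dim L] cancel. *)
by field; rewrite !nz ?fact_gt0.
Qed.
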